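(* For every positive integer $n$ there exist positive constants $c_n$ and $X_n$ such that for every $x>X_n$, $$\mathcal N_B(x)\gg_n e_n\big(c_n(\ln_{n+1}x)^2\big).$$
   Context: A Nov\'ak number is a positive integer $N$ such that $N$ divides $2^N+1$. For real $x$, $\mathcal N_B(x)$ denotes the number of Nov\'ak numbers $N\le x$. Iterated functions: $e_0(x)=x=\ln_0(x)$, $e_{i+1}(x)=e^{e_i(x)}$ and $\ln_{i+1}(x)=\ln(\ln_i(x))$ for $i\ge 0$. *)

(* Defs.v *)
From mathcomp Require Import all_boot all_order all_algebra.
From mathcomp Require Import all_classical all_reals all_analysis.

Set Implicit Arguments.
Unset Strict Implicit.
Unset Printing Implicit Defensive.

Local Open Scope ring_scope.

Definition novak (N : nat) : bool := ((0 < N) && (N %| 2 ^ N + 1))%N.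

(* For 0 < N, N <= Num.truncn x iff N%:R <= x; when x < 0, Num.truncn x = 0
   and the count is 0 since 0 is not a Novak number. *)
Definition novak_count (R : realType) (x : R) : nat :=
  #|[pred N : 'I_(Num.truncn x).+1 | novak N]|.

Definition iter_exp (R : realType) (i : nat) (x : R) : R := iter i expR x.

(* ln is total, with ln y = 0 for y <= 0: iter_ln i x is the genuine iterated
   logarithm as soon as x is large enough in terms of i. *)
Definition iter_ln (R : realType) (i : nat) (x : R) : R := iter i (@ln R) x.

(* Main.v *)
Require Import Defs.
From mathcomp Require Import all_boot all_order all_algebra all_field.
From mathcomp Require Import zify ring lra.
From mathcomp Require Import all_classical all_reals all_analysis.

Set Implicit Arguments.
Unset Strict Implicit.
Unset Printing Implicit Defensive.

Import Order.TTheory GRing.Theory Num.Theory.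

Local Open Scope ring_scope.

(** If N is a Novak number and d divides 2^N + 1, then N d is a Novak number.
    In particular, for a Novak number M the square M^2 is one too.  Put
    b = 2^M.  For each divisor d of M some prime p_d has b of order exactly 2d
    modulo p_d (a weak form of Zsigmondy's theorem, read off the value of the
    2d-th cyclotomic polynomial at b), so the p_d are distinct and divide
    b^M + 1 = 2^(M^2) + 1.  Hence the 2^tau(M) products of M^2 with a subset
    of the p_d are Novak numbers below 4^(M^2), and they all divide the largest
    one, whose number of divisors is therefore at least 2^tau(M).  Starting
    from 9 * 57^a, which has at least (a + 1)^2 divisors, each iteration of
    this construction adds one exponential to the bound and one logarithm to
    its argument. *)

(** * Values of cyclotomic polynomials and primes of prescribed order *)

Lemma Cyclotomic_mul_Xn_sub_1 (n e : nat) : (e %| n)%N -> (e < n)%N ->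
  exists g : {poly int}, 'X^n - 1 = 'Phi_n * ('X^e - 1) * g.
Proof.
move=> en ltn; have n0 : (0 < n)%N by case: n ltn en.
have e0 : (0 < e)%N by apply: dvdn_gt0 en.
rewrite -(prod_Cyclotomic n0) -(prod_Cyclotomic e0).
(* With the index [n] set apart, the other factors of ['X^n - 1] are split: indices dividing [e]
   rebuild ['X^e - 1], the rest form [g]. *)
rewrite (big_rem n) -?dvdn_divisors //= (bigID (fun d => d %| e)%N) /= mulrA.
set g := \prod_(_ <- _ | ~~ _) _; exists g; congr (_ * _ * _).
rewrite -big_filter; apply: perm_big; apply: uniq_perm.
- by rewrite filter_uniq // rem_uniq // divisors_uniq.
- exact: divisors_uniq.
move=> d; rewrite mem_filter mem_rem_uniq ?divisors_uniq // inE -!dvdn_divisors //.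
case de: (d %| e)%N => //=; rewrite (dvdn_trans de en) andbT.
by apply/eqP => dn; have := dvdn_leq e0 de; rewrite dn leqNgt ltn.
Qed.

(** Each factor [b - z ^ k] has norm at least [b - 1], since [z ^ k] lies on the unit circle, and
    the product is nonempty. *)
Lemma Cyclotomic_norm_ge (n b : nat) : (0 < n)%N -> (1 < b)%N ->
  (b.-1 <= `|('Phi_n).[b%:Z]|)%N.
Proof.
move=> n0 b1; have [z pz] := C_prim_root_exists n0.
rewrite -lez_nat abszE -(ler_int algC).
rewrite intr_norm -horner_map /= (Cintr_Cyclotomic pz) /cyclotomic horner_prod.
have b0 : (0 < b)%N by apply: ltn_trans b1.
have z1 k : `|z ^+ k| = 1.
  apply/eqP; rewrite normrX -(@pexpr_eq1 _ _ n) ?exprn_ge0 // -exprM mulnC exprM.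
  by rewrite -normrX (prim_expr_order pz) normr1 expr1n.
have ge k : (b.-1%:R : algC) <= `|b%:R - z ^+ k|.
  apply: le_trans (lerB_dist _ _); rewrite z1 normr_nat.
  by rewrite -[X in X%:R - 1](prednK b0) -natr1 addrK.
rewrite normr_prod.
under eq_bigr => i _ do rewrite !hornerE.
rewrite (@le_trans _ _ (\prod_(k < n | coprime k n) b.-1%:R)) //; last first.
  by apply: ler_prod => k _; rewrite ler0n /= ge.
rewrite prodr_const; set A := #|_|; have : (0 < A)%N.
  (* Reducing 1 modulo [n] covers [n = 1], where the index is 0. *)
  apply/card_gt0P; exists (Ordinal (ltn_pmod 1 n0)).
  by change (coprime (1 %% n) n); rewrite coprime_modl coprime1n.
case: A => // m _; rewrite exprS ler_peMr ?ler0n // exprn_ege1 // ler1n.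
by case: b b1 {b0 ge} => [|[]].
Qed.

(** First-order binomial expansion. At [m = p], an odd prime, the binomial term vanishes modulo
    [p ^ 2], so the sum is congruent to [p]. *)
Lemma geometric_sum_mod_sqr (p t m : nat) : exists s,
  (\sum_(i < m) (p * t).+1 ^ i = m + p * t * 'C(m, 2) + p ^ 2 * s)%N.
Proof.
have pw i : exists s, ((p * t).+1 ^ i = 1 + p * t * i + p ^ 2 * s)%N.
  elim: i => [|i [s IH]]; first by exists 0%N; rewrite expn0 !muln0.
  exists (t ^ 2 * i + s * (p * t).+1)%N; rewrite expnSr IH; ring.
elim: m => [|m [s IH]]; first by exists 0%N; rewrite big_ord0 !muln0.
have [r pr] := pw m; exists (s + r)%N.
rewrite big_ord_recr /= IH pr binS bin1; ring.
Qed.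


Lemma horner_Xn_sub_1 (b m : nat) : (0 < b)%N ->
  ('X^m - 1).[b%:Z] = (b ^ m - 1)%N%:Z.
Proof.
by move=> b0; rewrite !hornerE -subzn ?expn_gt0 ?b0 // -(natz (b ^ m)%N) natrX natz.
Qed.

Lemma Cyclotomic_factor (n e b : nat) : (e %| n)%N -> (e < n)%N -> (0 < b)%N ->
  exists k : nat, (b ^ n - 1 = `|('Phi_n).[b%:Z]| * (b ^ e - 1) * k)%N.
Proof.
move=> en ltn b0; have [g /(congr1 (horner^~ b%:Z))] := Cyclotomic_mul_Xn_sub_1 en ltn.
rewrite !hornerM !horner_Xn_sub_1 // => /(congr1 absz).
by rewrite !abszM => E; exists (`|g.[b%:Z]|)%N.
Qed.

(* A common root of Phi_n and X^e - 1 modulo p is a double root of X^n - 1,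
   hence kills the derivative n X^(n-1). *)
Lemma Cyclotomic_primitive_prime (n e b p : nat) :
  (e %| n)%N -> (e < n)%N -> (0 < b)%N -> prime p -> ~~ (p %| n)%N ->
  (p %| `|('Phi_n).[b%:Z]|)%N -> ~~ (p %| b ^ e - 1)%N.
Proof.
move=> en ltn b0 pp pn pPhi; apply/negP => pe.
have [g E] := Cyclotomic_mul_Xn_sub_1 en ltn.
have n0 : (0 < n)%N by apply: leq_trans ltn.
have /(congr1 (horner^~ b%:Z)) := congr1 deriv E.
have pe' : (p %| ('X^e - 1).[b%:Z])%Z.
  by rewrite horner_Xn_sub_1.
have pPhi' : (p %| ('Phi_n).[b%:Z])%Z by rewrite dvdzE.
rewrite derivB derivXn derivC subr0 !derivM hornerD !hornerM hornerD !hornerM.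
rewrite hornerMn hornerXn => D.
have : (p %| (b ^ n.-1 * n)%N%:Z)%Z.
  rewrite PoszM -(natz (b ^ _)%N) natrX natz -(natz n) mulr_natr D.
  apply: rpredD; last by rewrite -mulrA dvdz_mulr.
  by apply/dvdz_mulr/rpredD; [exact: dvdz_mull | exact: dvdz_mulr].
rewrite dvdzE /= Euclid_dvdM // (negbTE pn) orbF Euclid_dvdX // => /andP[pb _].
have : (p %| b ^ n - 1)%N.
  by have [k ->] := Cyclotomic_factor en ltn b0; rewrite -mulnA dvdn_mulr.
by rewrite dvdn_subr ?expn_gt0 ?b0 ?dvdn_exp // dvdn1 => /eqP p1; rewrite p1 in pp.
Qed.

(** Put [y = b ^ (n / p)]. The value at [b] divides the geometric sum [(y ^ p - 1) / (y - 1)]. If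
    [p] divides the value, then [y] is 1 modulo [p] by Fermat, and the sum is [p] modulo [p ^ 2]. *)
Lemma sqr_not_dvd_Cyclotomic (n b p : nat) : (1 < b)%N -> prime p -> odd p ->
  (0 < n)%N -> (p %| n)%N -> ~~ (p ^ 2 %| `|('Phi_n).[b%:Z]|)%N.
Proof.
move=> b1 pp po n0 pn; have p1 := prime_gt1 pp.
have b0 : (0 < b)%N by apply: leq_trans b1.
have [k E] := Cyclotomic_factor (dvdn_div pn) (ltn_Pdiv p1 n0) b0.
move: (`|_|%N) E => m E; apply/negP => p2.
have yp : (b ^ n = (b ^ (n %/ p)) ^ p)%N by rewrite -expnM divnK.
have y1 : (1 < b ^ (n %/ p))%N.
  have := ltn_exp2l 0 (n %/ p) b1.
  by rewrite expn0 => ->; rewrite divn_gt0 ?prime_gt0 //; apply: dvdn_leq.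
move: (b ^ (n %/ p))%N E yp y1 => y E yp y1.
have S : (y ^ p - 1 = (y - 1) * \sum_(i < p) y ^ i)%N.
  rewrite -[in LHS](exp1n p) subn_exp; congr muln.
  rewrite (reindex_inj rev_ord_inj); apply: eq_bigr => i _ /=.
  by rewrite exp1n muln1 subnS -predn_sub; congr (_ ^ _)%N; have := ltn_ord i; lia.
have py : (p %| y - 1)%N.
  have : (p %| y ^ p - 1)%N.
    rewrite -yp E -mulnA dvdn_mulr //; apply: dvdn_trans p2; exact: dvdn_exp.
  by rewrite -!eqn_mod_dvd ?expn_gt0 ?(ltnW y1) // fermat_little.
have PS : (p ^ 2 %| \sum_(i < p) y ^ i)%N.
  apply: dvdn_trans p2 _; apply/dvdnP; exists k.
  apply/eqP; rewrite -(eqn_pmul2l (m := y - 1)) ?subn_gt0 // -S -yp E.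
  by apply/eqP; ring.
have [t ty] := dvdnP py.
have yE : y = (p * t).+1 by rewrite mulnC -ty subn1 prednK // ltnW.
have [s Es] := geometric_sum_mod_sqr p t p.
move: PS; rewrite yE Es dvdn_addl; last exact: dvdn_mulr.
rewrite dvdn_addl; last first.
  rewrite expnS expn1 -mulnA dvdn_mul // dvdn_mull // prime_dvd_bin //=.
  exact: odd_prime_gt2.
by move/(dvdn_leq (prime_gt0 pp)); rewrite leqNgt -[X in (X < _)%N]expn1 ltn_exp2l.
Qed.

(** Otherwise every prime of the value divides [n]. These primes are odd because [b] is even, so
    each occurs only once; the value then divides [n], although it is at least [b - 1 > n]. *)
Lemma Cyclotomic_prime_divisor (n b : nat) : (1 < n)%N -> ~~ odd b -> (n.+1 < b)%N ->
  exists p : nat, [/\ prime p, ~~ (p %| n)%N & (p %| `|('Phi_n).[b%:Z]|)%N].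
Proof.
move=> n1 eb nb; have n0 := ltnW n1; have b1 : (1 < b)%N by apply: leq_trans nb.
set m := (`|('Phi_n).[b%:Z]|)%N.
have nm : (n < m)%N.
  by apply: leq_trans (Cyclotomic_norm_ge n0 b1); move: nb; lia.
have [/hasP [p]|/hasPn H] := boolP (has (fun p => ~~ (p %| n)%N) (primes m)).
  by rewrite mem_primes => /and3P[pp _ pm] pn; exists p.
have m0 : (0 < m)%N by apply: leq_trans nm.
suff /(dvdn_leq n0) : (m %| n)%N by rewrite leqNgt nm.
apply/dvdn_partP => // p pm; have := H p pm; rewrite negbK => pn.
move: pm; rewrite mem_primes => /and3P[pp _ pm].
suff l1 : (logn p m <= 1)%N.
  by rewrite p_part; apply: dvdn_trans pn; rewrite -[X in (_ %| X)%N]expn1 dvdn_exp2l.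
rewrite leqNgt -pfactor_dvdn //; apply: sqr_not_dvd_Cyclotomic => //.
case: (even_prime pp) => // p2.
have [k E] := Cyclotomic_factor (dvd1n n) n1 (ltnW b1).
have : (2 %| b ^ n - 1)%N by rewrite E -mulnA dvdn_mulr // -p2.
by rewrite dvdn2 oddB ?expn_gt0 ?(ltnW b1) // oddX (negbTE eb) orbF; case: (n) n1.
Qed.

(** The last two clauses say that [b] has order exactly [n] modulo [p]. The size condition on [b]
    avoids the exceptional cases of Zsigmondy's theorem. *)
Lemma primitive_prime_exists (n b : nat) : (1 < n)%N -> ~~ odd b -> (n.+1 < b)%N ->
  exists p : nat, [/\ prime p, (p %| b ^ n - 1)%N &
    forall e, (e %| n)%N -> (e < n)%N -> ~~ (p %| b ^ e - 1)%N].
Proof.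
move=> n1 eb nb; have b0 : (0 < b)%N by apply: leq_trans nb.
have [p [pp pn pPhi]] := Cyclotomic_prime_divisor n1 eb nb.
exists p; split=> // [|e en ltn];
  last exact: Cyclotomic_primitive_prime en ltn b0 pp pn pPhi.
by have [k ->] := Cyclotomic_factor (dvd1n n) n1 b0; rewrite -mulnA; apply: dvdn_mulr.
Qed.

(** * Divisibility of [b ^ n - 1] and [y ^ d + 1] *)

Lemma expn_mod1_gcd (p b m n : nat) : (0 < b)%N ->
  (p %| b ^ m - 1)%N -> (p %| b ^ n - 1)%N -> (p %| b ^ gcdn m n - 1)%N.
Proof.
move=> b0; have [->|m0] := posnP m; first by rewrite gcd0n.
rewrite -!eqn_mod_dvd ?expn_gt0 ?b0 // => /eqP pm /eqP pn.
case: (egcdnP n m0) => km kn E _.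
have : b ^ (km * m) = 1 %[mod p] by rewrite mulnC expnM -modnXm pm modnXm exp1n.
rewrite E expnD -modnMml (mulnC kn) expnM -(modnXm kn) pn modnXm exp1n modnMml mul1n.
by move=> ->.
Qed.

Lemma dvdn_exp_sub1_add1 (p b d : nat) : prime p ->
  (p %| b ^ (2 * d) - 1)%N -> ~~ (p %| b ^ d - 1)%N -> (p %| b ^ d + 1)%N.
Proof.
move=> pp; rewrite mulnC expnM -[X in (_ - X)%N](exp1n 2) subn_sqr Euclid_dvdM //.
by move=> /orP[->|].
Qed.

(** The cofactor is the alternating sum of the [d] first powers of [y]. As [-y] is 1 modulo [y + 1],
    this sum is congruent to [d] modulo [y + 1]. *)
Lemma dvdn_exp_add1 (y d : nat) : odd d ->
  exists2 k : nat, (y ^ d + 1 = (y + 1) * k)%N & (d %| y + 1)%N -> (d %| k)%N.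
Proof.
move=> od; set S : int := \sum_(i < d) (- y%:Z) ^+ i.
have E : (y ^ d + 1)%N%:Z = (y + 1)%N%:Z * S.
  have := subrX1 (- y%:Z) d; rewrite -/S exprNn -signr_odd od expr1 => E.
  rewrite !PoszD -(natz (y ^ d)%N) natrX natz.
  have -> : y%:Z ^+ d + 1 = - (-1 * y%:Z ^+ d - 1) by ring.
  rewrite E; ring.
exists (`|S|)%N; first by rewrite -[LHS]/(`|(y ^ d + 1)%N%:Z|)%N E abszM.
move=> dy; rewrite -[d in (d %| _)%N]/(`|d%:Z|)%N -dvdzE.
have -> : S = \sum_(i < d) ((- y%:Z) ^+ i - 1) + d%:Z.
  by rewrite sumrB sumr_const card_ord natz subrK.
rewrite rpredD // ?dvdzz // rpred_sum // => i _.
rewrite subrX1 dvdz_mulr // -opprD dvdzE abszN.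
exact: dy.
Qed.

(** * Novak numbers: closure, families and starting point *)

Lemma novak_odd N : novak N -> odd N.
Proof.
move=> /andP[N0 ND]; apply: contraT => eN.
have : (2 %| 2 ^ N + 1)%N by apply: dvdn_trans ND; rewrite dvdn2.
by rewrite dvdn_addr ?dvdn_exp.
Qed.

(** In the factorization of [2 ^ (N * d) + 1] by [2 ^ N + 1], the number [N] divides this factor and
    [d] divides the cofactor. *)
Lemma novak_mul N d : novak N -> (d %| 2 ^ N + 1)%N -> novak (N * d).
Proof.
move=> /andP[N0 ND] dD.
have od : odd d.
  apply: contraT => ed; have : (2 %| 2 ^ N + 1)%N by apply: dvdn_trans dD; rewrite dvdn2.
  by rewrite dvdn_addr ?dvdn_exp.
rewrite /novak muln_gt0 N0 odd_gt0 //= expnM.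
by have [k -> /(_ dD) dk] := dvdn_exp_add1 (2 ^ N) od; apply: dvdn_mul.
Qed.

(** Modulo [q d] the order of [2 ^ M] is [2 * d], so its [d]-th power is -1, and so is its [M]-th
    power since [M / d] is odd. Different orders force different primes. *)
Lemma novak_primes M : novak M -> (2 < M)%N -> exists q : nat -> nat,
  {in divisors M &, injective q} /\
  {in divisors M, forall d, prime (q d) /\ (q d %| 2 ^ (M * M) + 1)%N}.
Proof.
move=> nM M3; have oM := novak_odd nM; have M0 : (0 < M)%N by apply: ltn_trans M3.
have b0 : (0 < 2 ^ M)%N by rewrite expn_gt0.
have ex d : exists p : nat, d \in divisors M -> [/\ prime p,
    (p %| (2 ^ M) ^ (2 * d) - 1)%N &
    forall e, (e %| 2 * d)%N -> (e < 2 * d)%N -> ~~ (p %| (2 ^ M) ^ e - 1)%N].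
  have [dM|_] := boolP (d \in divisors M); last by exists 0%N.
  rewrite -dvdn_divisors // in dM; have dleM := dvdn_leq M0 dM.
  have d0 := dvdn_gt0 M0 dM.
  have [] := @primitive_prime_exists (2 * d) (2 ^ M); last by move=> p; exists p.
  - by rewrite mul2n -addnn; case: (d) d0 => // k; rewrite addnS.
  - by rewrite oddX /= orbF -lt0n.
  (* The induction starts at [M = 3], where this reads [7 < 8]. *)
  - suff : (2 * M + 1 < 2 ^ M)%N by apply: leq_trans; rewrite addn1 !ltnS leq_mul2l.
    rewrite -(subnK M3); elim: (M - 3)%N => // k IH.
    rewrite addSn expnS; move: IH; set z := (2 ^ _)%N; lia.
have {ex} [q qP] := boolp.choice ex; exists q; split=> [d1 d2|d] dD; last first.
  have [pp p2 pm] := qP _ dD; split=> //.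
  rewrite -dvdn_divisors // in dD; have d0 := dvdn_gt0 M0 dD.
  have pd : (q d %| (2 ^ M) ^ d + 1)%N.
    apply: dvdn_exp_sub1_add1 => //; apply: pm; first exact: dvdn_mull.
    by rewrite -[X in (X < _)%N]mul1n ltn_pmul2r.
  apply: dvdn_trans pd _.
  rewrite expnM -[X in (_ %| (2 ^ M) ^ X + 1)%N](divnK dD) mulnC expnM.
  have [|k -> _] := @dvdn_exp_add1 ((2 ^ M) ^ d) (M %/ d); last exact: dvdn_mulr.
  by move: oM; rewrite -{1}(divnK dD) oddM => /andP[].
move=> d2D E; have [_ p1 n1] := qP _ dD; have [_ p2 n2] := qP _ d2D.
rewrite -E in p2 n2; have G := expn_mod1_gcd b0 p1 p2.
(* Minimality of the order: [q d1] already divides the term with exponent the gcd, so the gcd cannot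
   be a proper divisor of [2 * d1] or of [2 * d2]. *)
have gE d : (0 < d)%N -> (gcdn (2 * d1) (2 * d2) %| d)%N ->
    (forall e, (e %| d)%N -> (e < d)%N -> ~~ (q d1 %| (2 ^ M) ^ e - 1)%N) ->
    gcdn (2 * d1) (2 * d2) = d.
  move=> d0 gd nd; apply/eqP; rewrite eqn_leq dvdn_leq //= leqNgt.
  by apply/negP => /(nd _ gd); rewrite G.
rewrite -!dvdn_divisors // in dD d2D.
have pos d : (d %| M)%N -> (0 < 2 * d)%N by move/(dvdn_gt0 M0); rewrite muln_gt0.
have := gE _ (pos _ dD) (dvdn_gcdl _ _) n1.
rewrite (gE _ (pos _ d2D) (dvdn_gcdr _ _) n2) => /eqP.
by rewrite eqn_pmul2l // => /eqP.
Qed.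

Lemma prod_primes_dvdn (m : nat) (s : seq nat) : uniq s ->
  {in s, forall p, prime p /\ (p %| m)%N} -> (\prod_(p <- s) p %| m)%N.
Proof.
elim: s => [|p s IH] /=; first by rewrite big_nil.
move=> /andP[ps us] H; rewrite big_cons Gauss_dvd.
  have [_ ->] := H p (mem_head _ _).
  by rewrite IH // => r rs; apply: H; rewrite inE rs orbT.
have [pp _] := H p (mem_head _ _); rewrite prime_coprime //.
apply: contra ps; rewrite Euclid_dvd_prod // big_has => /hasP[r rs].
have [pr _] := H r (mem_behead (s := p :: s) rs).
by rewrite dvdn_prime2 // => /eqP->.
Qed.

(** The element [L] comes from the full set of primes. Its divisors include the whole family, which
    is what the next iteration needs. *)
Lemma novak_family M : novak M -> (2 < M)%N -> exists s : seq nat,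
  [/\ uniq s, size s = (2 ^ size (divisors M))%N,
    {in s, forall N, [/\ novak N, (M <= N)%N & (N <= 4 ^ (M ^ 2))%N]} &
    exists2 L, L \in s & {in s, forall N, N %| L}%N].
Proof.
move=> nM M3; have [q [qI qP]] := novak_primes nM M3.
have M0 : (0 < M)%N by apply: ltn_trans M3.
have nMM : novak (M * M) by apply: novak_mul => //; case/andP: nM.
set k := size (divisors M).
pose r (i : 'I_k) := q (nth 0%N (divisors M) i).
have rD (i : 'I_k) : nth 0%N (divisors M) i \in divisors M by rewrite mem_nth.
have rI : injective r.
  move=> i j /qI; rewrite !rD => /(_ isT isT)/eqP.
  by rewrite nth_uniq ?divisors_uniq // => /eqP/val_inj.
have pr i : prime (r i) by case: (qP _ (rD i)).
pose f (A : {set 'I_k}) := (\prod_(i in A) r i)%N.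
have fS A : (f A %| f [set: 'I_k])%N.
  rewrite /f [X in (_ %| X)%N](finset.big_setID A) /= finset.setTI; exact: dvdn_mulr.
have fm : (f [set: 'I_k] %| 2 ^ (M * M) + 1)%N.
  have -> : f [set: 'I_k] = (\prod_(p <- [seq r i | i : 'I_k]) p)%N.
    by rewrite big_map big_enum /f; apply: eq_bigl => i; rewrite inE.
  apply: prod_primes_dvdn; first by rewrite map_inj_uniq // enum_uniq.
  by move=> p /mapP[i _ ->]; apply: qP.
(* A subset is recovered from its product by testing which primes divide it. *)
have fE A i : (r i %| f A)%N = (i \in A).
  rewrite Euclid_dvd_prod // big_orE; apply/exists_inP/idP => [[j jA]|iA].
    by rewrite dvdn_prime2 // => /eqP/rI->.
  by exists i.
have fI : injective f.
  by move=> A B AB; apply/finset.setP => i; rewrite -!fE AB.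
exists [seq (M * M * f A)%N | A : {set 'I_k}]; split.
- rewrite map_inj_uniq ?enum_uniq // => A B /eqP.
  by rewrite eqn_pmul2l ?muln_gt0 ?M0 // => /eqP/fI.
- rewrite size_map -cardE -finset.cardsT -finset.powersetT.
  by rewrite finset.card_powerset finset.cardsT card_ord.
- move=> _ /mapP[A _ ->].
  have fA : (f A %| 2 ^ (M * M) + 1)%N by apply: dvdn_trans (fS A) fm.
  have f0 : (0 < f A)%N by rewrite prodn_gt0 // => i; rewrite prime_gt0.
  split; first exact: novak_mul.
    by rewrite -mulnA leq_pmulr // muln_gt0 M0.
  (* With [u = M ^ 2] and [v = 2 ^ u], the bound [u * (v + 1) <= v * v] follows from [u < v]. *)
  apply: (@leq_trans (M * M * (2 ^ (M * M) + 1))).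
    by rewrite leq_mul2l dvdn_leq ?orbT // addn1.
  have -> : (4 ^ (M ^ 2) = 2 ^ (M ^ 2) * 2 ^ (M ^ 2))%N by rewrite -expnMn.
  rewrite (mulnn M).
  have : (M ^ 2 < 2 ^ (M ^ 2))%N by apply: ltn_expl.
  move: (M ^ 2)%N (2 ^ _)%N => b a; nia.
- exists (M * M * f [set: 'I_k])%N; first by apply: map_f; rewrite mem_enum.
  by move=> _ /mapP[A _ ->]; rewrite dvdn_mul.
Qed.

Lemma novak_count_ge (R : realType) (x : R) (s : seq nat) : uniq s ->
  {in s, forall N, novak N /\ N%:R <= x} -> (size s <= novak_count x)%N.
Proof.
move=> us sP.
have sT N : N \in s -> (N < (Num.truncn x).+1)%N.
  move=> /sP[/andP[N0 _] Nx]; rewrite ltnS truncn_ge_nat //.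
  by apply: le_trans Nx; rewrite ler0n.
rewrite /novak_count cardE -(size_map val); apply: uniq_leq_size => // N Ns.
apply/mapP; exists (Ordinal (sT N Ns)) => //.
by rewrite mem_enum inE /=; case: (sP N Ns).
Qed.

(** Here [57 = 3 * 19] divides [513 = 2 ^ 9 + 1], which divides [2 ^ (9 * 57 ^ a) + 1] because
    [57 ^ a] is odd. The divisors counted are [3 ^ i * 19 ^ j] with [i, j <= a]. *)
Lemma novak_base a : novak (9 * 57 ^ a) /\
  (a.+1 ^ 2 <= size (divisors (9 * 57 ^ a)))%N.
Proof.
have n0 : (0 < 9 * 57 ^ a)%N by rewrite muln_gt0 expn_gt0.
split.
  elim: a {n0} => // a IH; rewrite expnSr mulnA; apply: novak_mul => //.
  rewrite expnM -[(2 ^ 9)%N]/512%N.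
  apply: dvdn_trans (_ : 512 + 1 %| _)%N; first by [].
  have [|k -> _] := @dvdn_exp_add1 512 (57 ^ a); last exact: dvdn_mulr.
  by rewrite oddX orbT.
pose g (ij : 'I_a.+1 * 'I_a.+1) := (3 ^ ij.1 * 19 ^ ij.2)%N.
have gI : injective g.
  have l3 ij : logn 3 (g ij) = ij.1.
    by rewrite lognM ?expn_gt0 // !lognX logn_prime // muln1 logn_prime //= muln0 addn0.
  have l19 ij : logn 19 (g ij) = ij.2.
    by rewrite lognM ?expn_gt0 // !lognX !logn_prime //= muln0 muln1.
  move=> [i j] [i' j'] E; congr pair; apply: val_inj.
    by have := l3 (i, j); rewrite E l3.
  by have := l19 (i, j); rewrite E l19.
have <- : size [seq g ij | ij : 'I_a.+1 * 'I_a.+1] = (a.+1 ^ 2)%N.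
  by rewrite size_map -cardE card_prod card_ord.
apply: uniq_leq_size; first by rewrite map_inj_uniq // enum_uniq.
move=> _ /mapP[[i j] _ ->]; rewrite -dvdn_divisors // dvdn_mull //.
by rewrite -[57%N]/(3 * 19)%N expnMn dvdn_mul // dvdn_exp2l // -ltnS.
Qed.

(** * Iterated exponentials and logarithms *)

Lemma le_iter_exp (R : realType) (k : nat) : {homo @iter_exp R k : x y / x <= y}.
Proof. by elim: k => // k IH x y xy; rewrite /iter_exp !iterS ler_expR IH. Qed.

Lemma iter_exp_ge_id (R : realType) (k : nat) (x : R) : x <= iter_exp k x.
Proof.
elim: k => // k IH; rewrite /iter_exp iterS.
by apply: le_trans (expR_ge1Dx _); rewrite (le_trans IH) // lerDr.
Qed.

Lemma iter_lnSr (R : realType) (k : nat) (x : R) : iter_ln k.+1 x = iter_ln k (ln x).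
Proof. exact: iterSr. Qed.

(** This turns largeness of [x] into lower bounds on its iterated logarithms, with an explicit tower
    as threshold. *)
Lemma iter_ln_ge (R : realType) (k : nat) (A x : R) :
  iter_exp k A <= x -> A <= iter_ln k x.
Proof.
elim: k x => // k IH x; rewrite iter_lnSr /iter_exp iterS => le_x; apply: IH.
have x0 : 0 < x by apply: lt_le_trans le_x; exact: expR_gt0.
by rewrite -ler_expR lnK.
Qed.

(** It moves a factor 1/2 into the innermost argument: [expR e] is at least twice [expR (e / 2)],
    because [expR (e / 2) >= 1 + e / 2 >= 2]. *)
Lemma iter_exp_half (R : realType) (k : nat) (w : R) :
  2 <= w -> iter_exp k (w / 2) <= iter_exp k w / 2.
Proof.
move=> w2; elim: k => // k IH; rewrite /iter_exp !iterS -!/(iter_exp _ _).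
have ge2 := le_trans w2 (iter_exp_ge_id k w).
move: (iter_exp k w) ge2 IH => e e2 IH.
apply: (@le_trans _ _ (expR (e / 2))); first by rewrite ler_expR.
have -> : expR e = expR (e / 2) * expR (e / 2) by rewrite -expRD -splitr.
have := expR_ge1Dx (e / 2); have := expR_gt0 (e / 2); nra.
Qed.

(** A logarithm turns the factor 1/4 into a loss of [ln 4], at most half of [ln u] when [u >= 16];
    so a quarter of [ln u] still remains. *)
Lemma iter_ln_quarter (R : realType) (k : nat) (z : R) : iter_exp k 16 <= z ->
  iter_ln k z / 4 <= iter_ln k (z / 4).
Proof.
elim: k => // k IH; rewrite /iter_exp /iter_ln !iterS.
rewrite -!/(iter_exp _ _) -!/(iter_ln _ _) => le_z.
have le_z' : iter_exp k 16 <= z.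
  apply: le_trans le_z; apply: le_trans (expR_ge1Dx _); by rewrite lerDr.
have u16 := iter_ln_ge le_z'; have := IH le_z'.
move: (iter_ln k z) (iter_ln k (z / 4)) u16 => u v u16 uv.
have u4 : 0 < u / 4 by lra.
apply: (@le_trans _ _ (ln (u / 4))); last by rewrite ler_ln ?posrE // (lt_le_trans u4).
have l16 : ln (16 : R) = ln 4 + ln 4.
  by rewrite -lnM ?posrE //; congr ln; lra.
have : ln 16 <= ln u by rewrite ler_ln ?posrE //; lra.
have : 0 <= ln (4 : R) by rewrite ln_ge0 //; lra.
rewrite ln_div ?posrE //; lra.
Qed.

Lemma expR_half_le2 (R : realType) : expR (1 / 2 : R) <= 2.
Proof.
have := expR_ge1Dx (- (1 / 2) : R); have := expR_gt0 (1 / 2 : R).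
rewrite expRN => e0; move: (expR _) e0 => e e0 he.
have := mulfV (lt0r_neq0 e0); nra.
Qed.

(** * Passing from [x] to a fourth root of [ln x], and the iteration *)

Lemma near_descent (R : realType) (k : nat) (c : R) : 0 < c ->
  \forall x \near +oo,
  let y := expR (ln (ln x) / 4) in
  (forall M : nat, M%:R <= y -> (4 ^ (M ^ 2))%:R <= x) /\
  (forall t : nat, iter_exp k (c * iter_ln k.+1 y ^+ 2) <= t%:R ->
     iter_exp k.+1 (c / 32 * iter_ln k.+2 x ^+ 2) <= (2 ^ t)%:R).
Proof.
move=> c0; near=> x; set y := expR _.
have L4 : 4 <= ln (ln x).
  apply: (@iter_ln_ge _ 2); near: x; apply: nbhs_pinfty_ge; exact: num_real.
have Lk : iter_exp k 16 <= ln (ln x).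
  apply: (@iter_ln_ge _ 2); near: x; apply: nbhs_pinfty_ge; exact: num_real.
(* This threshold gives [c * u ^ 2 >= 32], by [u ^ 2 >= 2 * u - 1], so that the argument
   [c * u ^ 2 / 16] to be halved is at least 2. *)
have u1 : 1 + 32 / c <= iter_ln k (ln (ln x)).
  rewrite -!iter_lnSr; apply: iter_ln_ge; near: x.
  apply: nbhs_pinfty_ge; exact: num_real.
have lx0 : 0 < ln x.
  by rewrite ltNge; apply/negP => /ln0 l0; rewrite l0 in L4; lra.
have x0 : 0 < x.
  by rewrite ltNge; apply/negP => /ln0 l0; rewrite l0 in lx0; lra.
have y2 : 2 <= y by apply: le_trans (expR_ge1Dx _); lra.
split=> [M My|t].
  have y4 : y ^+ 4 = ln x.
    by rewrite -expRM_natl mulrC divfK ?lnK.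
  have e4 : 4 <= expR 3 :> R by apply: le_trans (expR_ge1Dx _); lra.
  rewrite natrX -[leRHS]lnK ?posrE // -y4.
  (* It remains that [3 * M ^ 2 <= y ^ 4 = ln x], which holds as [M <= y] and [y ^ 2 >= 4]. *)
  apply: (@le_trans _ _ (expR 3 ^+ (M ^ 2))).
    by rewrite lerXn2r ?nnegrE ?expR_ge0.
  rewrite -expRM_natl ler_expR natrX.
  have M0 : 0 <= M%:R :> R by rewrite ler0n.
  have My2 : M%:R ^+ 2 <= y ^+ 2 by rewrite lerXn2r ?nnegrE // (le_trans M0).
  have y4' : 4 <= y ^+ 2 by rewrite expr2; nra.
  have -> : y ^+ 4 = y ^+ 2 * y ^+ 2 by rewrite -exprD.
  move: (y ^+ 2) (M%:R ^+ 2) My2 y4' (exprn_ge0 2 M0) => a b; nra.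
rewrite !iter_lnSr expRK.
have := iter_ln_quarter Lk; move: (iter_ln k (_ / 4)) (iter_ln k _) u1 => v u u1 uv le_t.
have c32 : c * (32 / c) = 32 by field; rewrite gt_eqF.
have d0 : 0 < 32 / c by rewrite divr_gt0.
have cu : 32 <= c * u ^+ 2.
  rewrite -[leLHS]c32 ler_pM2l //; have := sqr_ge0 (u - 1); rewrite !expr2; lra.
have cv : c * u ^+ 2 / 16 <= c * v ^+ 2.
  rewrite -mulrA ler_pM2l //; have u0 : 0 <= u by lra.
  have -> : u ^+ 2 / 16 = (u / 4) ^+ 2 by field.
  by rewrite lerXn2r ?nnegrE //; lra.
have w2 : 2 <= c * u ^+ 2 / 16 by lra.
have := le_trans (le_iter_exp k cv) le_t; have := iter_exp_half k w2.
(* The constant 32 is 16, from squaring the quarter in [ln y], times 2, from replacing [2 ^ t] by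
   the smaller [expR (t / 2)]. *)
have -> : c * u ^+ 2 / 16 / 2 = c / 32 * u ^+ 2 by field.
move=> h1 h2; rewrite /iter_exp iterS -/(iter_exp _ _).
apply: (@le_trans _ _ (expR (t%:R * (1 / 2)))).
  by rewrite ler_expR; lra.
by rewrite expRM_natl natrX lerXn2r ?nnegrE ?expR_ge0 // expR_half_le2.
Unshelve. all: by end_near. Qed.

Lemma near_expR_quarter (R : realType) (P : R -> Prop) : (\forall y \near +oo, P y) ->
  \forall x \near +oo, P (expR (ln (ln x) / 4)).
Proof.
move=> [Y [_ YP]]; near=> x; apply: YP.
apply: lt_le_trans (expR_ge1Dx _).
have : 4 * Y <= ln (ln x).
  apply: (@iter_ln_ge _ 2); near: x; apply: nbhs_pinfty_ge; exact: num_real.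
lra.
Unshelve. all: by end_near. Qed.

(** The induction carries numbers of divisors: an [M] below the fourth root of [ln x] yields an
    [L <= x] with at least [2 ^ size (divisors M)] divisors. *)
Lemma near_novak_divisors (R : realType) (k : nat) :
  exists2 c : R, 0 < c & \forall y \near +oo,
  exists M : nat, [/\ novak M, (2 < M)%N, M%:R <= y &
    iter_exp k (c * iter_ln k.+1 y ^+ 2) <= (size (divisors M))%:R].
Proof.
elim: k => [|k [c c0 IH]].
  (* With [a] the integer part of [ln y / 112], the bounds [9 <= expR 8] and [57 <= expR 56] give
     [9 * 57 ^ a <= expR (8 + ln y / 2) <= y], once [ln y >= 16]. *)
  exists (112^-1 ^+ 2); first by rewrite exprn_gt0 // invr_gt0.
  near=> y; have ly : 16 <= ln y.
    apply: (@iter_ln_ge _ 1); near: y; apply: nbhs_pinfty_ge; exact: num_real.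
  have y0 : 0 < y by near: y; apply: nbhs_pinfty_gt; exact: num_real.
  have ly0 : 0 <= ln y / 112 by lra.
  have /andP[a1 a2] := truncn_itv ly0; set a := Num.truncn _ in a1 a2.
  have [na ta] := novak_base a; exists (9 * 57 ^ a)%N; split=> //.
  - by apply: (@leq_trans 9) => //; rewrite leq_pmulr // expn_gt0.
  - rewrite -[leRHS]lnK ?posrE // natrM natrX.
    apply: (@le_trans _ _ (expR 8 * expR 56 ^+ a)).
      apply: ler_pM; rewrite ?exprn_ge0 //; first by apply: le_trans (expR_ge1Dx _); lra.
      by rewrite lerXn2r ?nnegrE ?expR_ge0 //; apply: le_trans (expR_ge1Dx _); lra.
    by rewrite -expRM_natl -expRD ler_expR; lra.
  - apply: (@le_trans _ _ (a.+1 ^ 2)%:R); last by rewrite ler_nat.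
    rewrite /= -exprMn natrX lerXn2r ?nnegrE //; rewrite mulrC //; exact: ltW.
exists (c / 32); first by rewrite divr_gt0.
apply: filterS2 (near_descent k c0) (near_expR_quarter IH).
move=> x [h1 h2] [M [nM M3 My]] /h2 ht.
have [s [us ss sP [L Ls LP]]] := novak_family nM M3; have [nL ML Lle] := sP _ Ls.
exists L; split=> //; first exact: leq_trans ML.
  by apply: le_trans (h1 _ My); rewrite ler_nat.
apply: le_trans ht _; rewrite ler_nat -ss; apply: uniq_leq_size => // N Ns.
by case/andP: nL => L0 _; rewrite -dvdn_divisors // LP.
Unshelve. all: by end_near. Qed.

Theorem theorem2 (R : realType) (n : nat) (hn : (0 < n)%N) :
  exists c X K : R, [/\ 0 < c, 0 < X, 0 < K &
    forall x : R, X < x ->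
      K * iter_exp n (c * iter_ln n.+1 x ^+ 2) <= (novak_count x)%:R].
Proof.
(* For [n = k + 1], the divisor bound at level [k] is followed by one last family, whose members are
   counted directly. *)
case: n hn => // k _; have [c c0 near_M] := near_novak_divisors R k.
have : \forall x \near +oo,
    iter_exp k.+1 (c / 32 * iter_ln k.+2 x ^+ 2) <= (novak_count x)%:R.
  apply: filterS2 (near_descent k c0) (near_expR_quarter near_M).
  move=> x [h1 h2] [M [nM M3 My]] /h2 ht.
  have [s [us ss sP _]] := novak_family nM M3.
  apply: le_trans ht _; rewrite ler_nat -ss; apply: novak_count_ge => // N /sP[nN _ Nle].
  by split=> //; apply: le_trans (h1 _ My); rewrite ler_nat.
(* The implied constant is 1; the maximum makes the threshold positive. *)
move=> [X [_ XP]]; exists (c / 32), (Num.max X 1), 1; split=> //.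
- by rewrite divr_gt0.
- by rewrite lt_max ltr01 orbT.
- by move=> x; rewrite gt_max mul1r => /andP[/XP].
Qed.
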